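(* Let $\mathcal M=\langle M,\in^{\mathcal M},X^{\mathcal M}\rangle$ be an $\mathcal L_X$-structure with $\mathcal M\models\mathrm{ZFC}(X)$. If $\mathcal N=\langle N,\in^{\mathcal N}\rangle$ is an $\mathcal L$-structure such that $\langle M,\in^{\mathcal M}\rangle\prec_{\mathrm{cf}}\mathcal N$, then there exists $X^{\mathcal N}$ with $X^{\mathcal M}\subseteq X^{\mathcal N}\subseteq N$ such that $\mathcal M\prec\langle N,\in^{\mathcal N},X^{\mathcal N}\rangle$.
   Context: $\mathcal{L}$ is the language with one binary relation $\in$, and $\mathcal L_X$ is $\mathcal L$ extended by a new unary predicate $X$. $\mathrm{ZFC}(X)$ is $\mathrm{ZFC}$ together with the separation and collection schemes for all $\mathcal L_X$-formulae. $\langle M,\in^{\mathcal M}\rangle\prec_{\mathrm{cf}}\mathcal N$ means $\mathcal N$ is an elementary extension of $\langle M,\in^{\mathcal M}\rangle$ and for every $x\in N$ there is $y\in M$ with $\mathcal N\models x\in y$. $\prec$ denotes elementary substructure (here in the language $\mathcal L_X$). *)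

(* Defs.v *)
From Stdlib Require Import Arith.

(* A language is given by the type of its unary predicate symbols; the binary
   relation symbol and equality are always present. *)
Definition L : Type := Empty_set.
Definition LX : Type := unit.

(* Variables are named by natural numbers. *)
Inductive form (U : Type) : Type :=
| Mem (x y : nat)
| Eq (x y : nat)
| Pred (u : U) (x : nat)
| Bot
| Imp (p q : form U)
| All (x : nat) (p : form U).

Arguments Mem {U} x y.
Arguments Eq {U} x y.
Arguments Pred {U} u x.
Arguments Bot {U}.
Arguments Imp {U} p q.
Arguments All {U} x p.

Definition Not {U} (p : form U) : form U := Imp p Bot.
Definition And {U} (p q : form U) : form U := Not (Imp p (Not q)).
Definition Or {U} (p q : form U) : form U := Imp (Not p) q.
Definition Iff {U} (p q : form U) : form U := And (Imp p q) (Imp q p).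
Definition Ex {U} (x : nat) (p : form U) : form U := Not (All x (Not p)).
Definition AllIn {U} (x a : nat) (p : form U) : form U := All x (Imp (Mem x a) p).
Definition ExIn {U} (x a : nat) (p : form U) : form U := Ex x (And (Mem x a) p).

Fixpoint free {U} (z : nat) (p : form U) : Prop :=
  match p with
  | Mem x y => z = x \/ z = y
  | Eq x y => z = x \/ z = y
  | Pred _ x => z = x
  | Bot => False
  | Imp p q => free z p \/ free z q
  | All x p => z <> x /\ free z p
  end.

Record structure (U : Type) : Type := Structure {
  dom :> Type;
  dom_inhabited : inhabited dom;
  mem : dom -> dom -> Prop;
  pred : U -> dom -> Prop
}.

Arguments Structure {U} dom dom_inhabited mem pred.
Arguments dom {U} _.
Arguments dom_inhabited {U} _.
Arguments mem {U} _ _ _.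
Arguments pred {U} _ _ _.

Definition upd {D : Type} (v : nat -> D) (x : nat) (d : D) : nat -> D :=
  fun y => if Nat.eqb y x then d else v y.

Fixpoint sat {U} (M : structure U) (v : nat -> M) (p : form U) : Prop :=
  match p with
  | Mem x y => mem M (v x) (v y)
  | Eq x y => v x = v y
  | Pred u x => pred M u (v x)
  | Bot => False
  | Imp p q => sat M v p -> sat M v q
  | All x p => forall d : M, sat M (upd v x d) p
  end.

(* A formula with free variables is identified with its universal closure. *)
Definition models {U} (M : structure U) (T : form U -> Prop) : Prop :=
  forall p, T p -> forall v : nat -> M, sat M v p.

Definition Extensionality {U} : form U :=
  All 0 (All 1 (Imp (All 2 (Iff (Mem 2 0) (Mem 2 1))) (Eq 0 1))).

Definition Foundation {U} : form U :=
  All 0 (Imp (Ex 1 (Mem 1 0)) (ExIn 1 0 (Not (ExIn 2 1 (Mem 2 0))))).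

Definition Pairing {U} : form U :=
  All 0 (All 1 (Ex 2 (All 3 (Iff (Mem 3 2) (Or (Eq 3 0) (Eq 3 1)))))).

Definition Union {U} : form U :=
  All 0 (Ex 1 (All 2 (Iff (Mem 2 1) (ExIn 3 0 (Mem 2 3))))).

Definition Powerset {U} : form U :=
  All 0 (Ex 1 (All 2 (Iff (Mem 2 1) (AllIn 3 2 (Mem 3 0))))).

Definition Infinity {U} : form U :=
  Ex 0 (And (ExIn 1 0 (All 2 (Not (Mem 2 1))))
            (AllIn 1 0 (ExIn 2 0
               (All 3 (Iff (Mem 3 2) (Or (Mem 3 1) (Eq 3 1))))))).

(* Every family of nonempty, pairwise disjoint sets has a set meeting each
   member in exactly one element. *)
Definition Choice {U} : form U :=
  All 0 (Imp (And (AllIn 1 0 (Ex 2 (Mem 2 1)))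
                  (AllIn 1 0 (AllIn 2 0
                     (Imp (ExIn 3 1 (Mem 3 2)) (Eq 1 2)))))
             (Ex 4 (AllIn 1 0
                (Ex 2 (All 3 (Iff (And (Mem 3 1) (Mem 3 4)) (Eq 3 2))))))).

Definition Separation {U} (x a b : nat) (p : form U) : form U :=
  All a (Ex b (All x (Iff (Mem x b) (And (Mem x a) p)))).

Definition Collection {U} (x y a b : nat) (p : form U) : form U :=
  All a (Imp (AllIn x a (Ex y p)) (Ex b (AllIn x a (ExIn y b p)))).

(* With U = L this is ZFC; with U = LX it is ZFC(X). Replacement follows from
   Separation and Collection. *)
Inductive ZFC (U : Type) : form U -> Prop :=
| ZFC_ext : ZFC U Extensionality
| ZFC_found : ZFC U Foundation
| ZFC_pair : ZFC U Pairing
| ZFC_union : ZFC U Union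
| ZFC_power : ZFC U Powerset
| ZFC_inf : ZFC U Infinity
| ZFC_choice : ZFC U Choice
| ZFC_sep (x a b : nat) (p : form U) :
    x <> a -> x <> b -> a <> b -> ~ free b p ->
    ZFC U (Separation x a b p)
| ZFC_coll (x y a b : nat) (p : form U) :
    x <> y -> x <> a -> x <> b -> y <> a -> y <> b -> a <> b -> ~ free b p ->
    ZFC U (Collection x y a b p).

(* The inclusion of a structure in an extension is an explicit map; injectivity
   and preservation of the relations are the atomic cases. *)
Definition elementary {U} (M N : structure U) (i : M -> N) : Prop :=
  forall (p : form U) (v : nat -> M),
    sat M v p <-> sat N (fun n => i (v n)) p.

Definition cofinal_elementary {U} (M N : structure U) (i : M -> N) : Prop :=
  elementary M N i /\ forall x : N, exists y : M, mem N x (i y).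

Definition reduct (M : structure LX) : structure L :=
  Structure (dom M) (dom_inhabited M) (mem M)
            (fun u : L => match u with end).

Definition expand (N : structure L) (XN : N -> Prop) : structure LX :=
  Structure (dom N) (dom_inhabited N) (mem N) (fun _ : LX => XN).

(* Main.v *)
From Stdlib Require Import Arith Lia Classical FunctionalExtensionality.
Require Import Defs.

(** Put [XN := \bigcup_c (i c)], where [c] ranges over the sets of [M] all of
    whose elements satisfy [X].  By Separation and Collection for [LX], each
    [LX]-formula [p] whose arguments range over a fixed set [a] of [M] agrees
    with an [L]-formula with parameters in [M]: replace [X] by a large enough
    set [c] and bound each quantifier by a large enough set [b].  By cofinality
    every finite tuple of [N] lies in some [i a], and induction on [p] shows
    that the same [L]-formula computes [p] in [(N, XN)] on [i a].  In the
    quantifier step a witness in [N] may lie outside [i b], but then it lies in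
    [i b'] for some larger [b'], and the statement that [b'] yields no more
    witnesses than [b] is first order in [L], so it transfers from [M]. *)

(** * Assignments and formulas *)

Lemma upd_same {D : Type} (v : nat -> D) x d : upd v x d x = d.
Proof. unfold upd; now rewrite Nat.eqb_refl. Qed.

Lemma upd_other {D : Type} (v : nat -> D) x d y : y <> x -> upd v x d y = v y.
Proof. intros H; unfold upd; now apply Nat.eqb_neq in H as ->. Qed.

Lemma upd_self {D : Type} (v : nat -> D) x : upd v x (v x) = v.
Proof.
  apply functional_extensionality; intros y; unfold upd.
  now destruct (Nat.eqb_spec y x) as [->|].
Qed.

Lemma upd_upd {D : Type} (v : nat -> D) x d e : upd (upd v x d) x e = upd v x e.
Proof.
  apply functional_extensionality; intros y; unfold upd.
  now destruct (Nat.eqb_spec y x).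
Qed.

Section Connectives.
Context {U : Type} (M : structure U).

Lemma sat_And (v : nat -> M) p q : sat M v (And p q) <-> sat M v p /\ sat M v q.
Proof. cbn; split; [intros H; split; apply NNPP|]; tauto. Qed.

Lemma sat_Or (v : nat -> M) p q : sat M v (Or p q) <-> sat M v p \/ sat M v q.
Proof. cbn; destruct (classic (sat M v p)); tauto. Qed.

Lemma sat_Iff (v : nat -> M) p q : sat M v (Iff p q) <-> (sat M v p <-> sat M v q).
Proof. unfold Iff; rewrite sat_And; cbn; tauto. Qed.

Lemma sat_Ex (v : nat -> M) x p : sat M v (Ex x p) <-> exists d, sat M (upd v x d) p.
Proof.
  cbn; split.
  - intros H; apply NNPP; intros H'; apply H; intros d Hd; eauto.
  - intros [d Hd] H; exact (H d Hd).
Qed.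

Lemma sat_ExIn (v : nat -> M) x a p : x <> a ->
  sat M v (ExIn x a p) <-> exists d, mem M d (v a) /\ sat M (upd v x d) p.
Proof.
  intros xa; unfold ExIn; rewrite sat_Ex.
  split; intros [d H]; exists d; revert H; rewrite sat_And; cbn;
    rewrite upd_same, upd_other by congruence; easy.
Qed.

Lemma sat_AllIn (v : nat -> M) x a p : x <> a ->
  sat M v (AllIn x a p) <-> forall d, mem M d (v a) -> sat M (upd v x d) p.
Proof.
  intros xa; cbn; split; intros H d; specialize (H d); revert H;
    rewrite upd_same, upd_other by congruence; easy.
Qed.

End Connectives.

(** Bound variables count too. Hence every index from [n] on is fresh for [p], and each quantifier
    of [p] updates an assignment only below [n], where boxes constrain it. *)
Fixpoint vars_below {U} (n : nat) (p : form U) : Prop :=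
  match p with
  | Mem x y | Eq x y => x < n /\ y < n
  | Pred _ x => x < n
  | Bot => True
  | Imp p q => vars_below n p /\ vars_below n q
  | All x p => x < n /\ vars_below n p
  end.

Lemma vars_below_le {U} (p : form U) m n :
  m <= n -> vars_below m p -> vars_below n p.
Proof. induction p; cbn; intuition lia. Qed.

Lemma vars_below_exists {U} (p : form U) : exists n, vars_below n p.
Proof.
  induction p as [x y|x y|u x| |p [m Hm] q [n Hn]|x p [m Hm]]; cbn.
  - exists (S (x + y)); lia.
  - exists (S (x + y)); lia.
  - exists (S x); lia.
  - now exists 0.
  - exists (m + n); split; [apply (vars_below_le p m)|apply (vars_below_le q n)];
      easy || lia.
  - exists (S (x + m)); split; [lia|]; apply (vars_below_le p m); easy || lia.
Qed.

Lemma vars_below_not_free {U} (p : form U) n : vars_below n p -> ~ free n p.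
Proof. induction p; cbn; intuition lia. Qed.

Lemma sat_agree {U} (M : structure U) (p : form U) n : vars_below n p ->
  forall v w : nat -> M, (forall k, k < n -> v k = w k) ->
  sat M v p <-> sat M w p.
Proof.
  induction p as [x y|x y|u x| |p IHp q IHq|x p IHp]; cbn; intros Hp v w E.
  - now rewrite !E by tauto.
  - now rewrite !E by tauto.
  - now rewrite !E by tauto.
  - easy.
  - now rewrite (IHp (proj1 Hp) v w), (IHq (proj2 Hp) v w).
  - assert (E' : forall d k, k < n -> upd v x d k = upd w x d k).
    { intros d k Hk; unfold upd; destruct (Nat.eqb k x); auto. }
    split; intros H d; now apply (IHp (proj2 Hp) _ _ (E' d)).
Qed.

Fixpoint rename {U} (f : nat -> nat) (p : form U) : form U :=
  match p with
  | Mem x y => Mem (f x) (f y)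
  | Eq x y => Eq (f x) (f y)
  | Pred u x => Pred u (f x)
  | Bot => Bot
  | Imp p q => Imp (rename f p) (rename f q)
  | All x p => All (f x) (rename f p)
  end.

(** Injectivity prevents a renamed quantifier from capturing another variable. *)
Lemma sat_rename {U} (M : structure U) (f : nat -> nat) (p : form U) :
  (forall x y, f x = f y -> x = y) ->
  forall v : nat -> M, sat M v (rename f p) <-> sat M (fun k => v (f k)) p.
Proof.
  intros f_inj.
  induction p as [x y|x y|u x| |p IHp q IHq|x p IHp]; cbn; intros v; try easy.
  - now rewrite IHp, IHq.
  - assert (E : forall d, (fun k => upd v (f x) d (f k)) = upd (fun k => v (f k)) x d).
    { intros d; apply functional_extensionality; intros k; unfold upd.
      destruct (Nat.eqb_spec k x) as [->|ne]; [now rewrite Nat.eqb_refl|].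
      now destruct (Nat.eqb_spec (f k) (f x)) as [e|]; [apply f_inj in e|]. }
    split; intros H d; specialize (H d); revert H; now rewrite IHp, E.
Qed.

(** * Relations defined by the same formula in both structures *)

(* Even positions carry the arguments, odd positions the parameters. *)
Definition mix {D : Type} (v w : nat -> D) : nat -> D :=
  fun k => if Nat.even k then v (Nat.div2 k) else w (Nat.div2 k).

Lemma mix_even {D : Type} (v w : nat -> D) k : mix v w (2 * k) = v k.
Proof. unfold mix; now rewrite Nat.even_even, Nat.div2_double. Qed.

Lemma mix_odd {D : Type} (v w : nat -> D) k : mix v w (2 * k + 1) = w k.
Proof.
  unfold mix; rewrite Nat.even_odd, Nat.add_1_r; now rewrite Nat.div2_succ_double.
Qed.

Lemma even_odd_cases k : exists j, k = 2 * j \/ k = 2 * j + 1.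
Proof. destruct (Nat.Even_or_Odd k) as [[j ->]|[j ->]]; exists j; auto. Qed.

Lemma mix_upd {D : Type} (v w : nat -> D) x d :
  upd (mix v w) (2 * x) d = mix (upd v x d) w.
Proof.
  apply functional_extensionality; intros k.
  destruct (even_odd_cases k) as [j [->| ->]].
  - rewrite mix_even; unfold upd at 2.
    destruct (Nat.eqb_spec j x) as [->|]; [now rewrite upd_same|].
    rewrite upd_other by lia; apply mix_even.
  - rewrite upd_other by lia; now rewrite !mix_odd.
Qed.

Lemma comp_mix {D E : Type} (f : D -> E) (v w : nat -> D) :
  (fun n => f (mix v w n)) = mix (fun n => f (v n)) (fun n => f (w n)).
Proof.
  apply functional_extensionality; intros k; unfold mix.
  now destruct (Nat.even k).
Qed.

(** To combine two formulas with separate parameter lists, the lists are interleaved. Both renamings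
    fix the argument positions; parameter [j] moves to parameter [2 * j] under the left one and to
    [2 * j + 1] under the right one. *)
Definition left_params (k : nat) : nat := if Nat.even k then k else 2 * k - 1.
Definition right_params (k : nat) : nat := if Nat.even k then k else 2 * k + 1.

Lemma left_params_inj x y : left_params x = left_params y -> x = y.
Proof.
  unfold left_params.
  destruct (even_odd_cases x) as [j [->| ->]], (even_odd_cases y) as [l [->| ->]];
    rewrite ?Nat.even_even, ?Nat.even_odd; lia.
Qed.

Lemma right_params_inj x y : right_params x = right_params y -> x = y.
Proof.
  unfold right_params.
  destruct (even_odd_cases x) as [j [->| ->]], (even_odd_cases y) as [l [->| ->]];
    rewrite ?Nat.even_even, ?Nat.even_odd; lia.
Qed.

Lemma mix_left_params {D : Type} (v w1 w2 : nat -> D) :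
  (fun k => mix v (mix w1 w2) (left_params k)) = mix v w1.
Proof.
  apply functional_extensionality; intros k; unfold left_params.
  destruct (even_odd_cases k) as [j [->| ->]];
    rewrite ?Nat.even_even, ?Nat.even_odd.
  - now rewrite !mix_even.
  - replace (2 * (2 * j + 1) - 1) with (2 * (2 * j) + 1) by lia.
    now rewrite !mix_odd, mix_even.
Qed.

Lemma mix_right_params {D : Type} (v w1 w2 : nat -> D) :
  (fun k => mix v (mix w1 w2) (right_params k)) = mix v w2.
Proof.
  apply functional_extensionality; intros k; unfold right_params.
  destruct (even_odd_cases k) as [j [->| ->]];
    rewrite ?Nat.even_even, ?Nat.even_odd.
  - now rewrite !mix_even.
  - now rewrite !mix_odd.
Qed.

Section Codefinable.
Context {U : Type} (A N : structure U) (i : A -> N).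

(** Working with pairs of relations instead of translated formulas makes it unnecessary to
    substitute a set for [X] syntactically: closure under the connectives and quantifiers
    suffices. *)
Definition codefinable (R : (nat -> A) -> Prop) (S : (nat -> N) -> Prop) : Prop :=
  exists (q : form U) (w : nat -> A),
    (forall v, R v <-> sat A (mix v w) q) /\
    (forall v, S v <-> sat N (mix v (fun n => i (w n))) q).

Lemma codefinable_mem x y :
  codefinable (fun v => mem A (v x) (v y)) (fun v => mem N (v x) (v y)).
Proof.
  destruct (dom_inhabited A) as [c].
  exists (Mem (2 * x) (2 * y)), (fun _ => c).
  split; intros v; cbn -[Nat.mul]; now rewrite !mix_even.
Qed.

Lemma codefinable_eq x y :
  codefinable (fun v => v x = v y) (fun v => v x = v y).
Proof.
  destruct (dom_inhabited A) as [c].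
  exists (Eq (2 * x) (2 * y)), (fun _ => c).
  split; intros v; cbn -[Nat.mul]; now rewrite !mix_even.
Qed.

Lemma codefinable_mem_param x c :
  codefinable (fun v => mem A (v x) c) (fun v => mem N (v x) (i c)).
Proof.
  exists (Mem (2 * x) 1), (fun _ => c).
  split; intros v; cbn -[Nat.mul]; now rewrite !mix_even.
Qed.

Lemma codefinable_bot : codefinable (fun _ => False) (fun _ => False).
Proof. destruct (dom_inhabited A) as [c]; now exists Bot, (fun _ => c). Qed.

Lemma codefinable_imp R S R' S' : codefinable R S -> codefinable R' S' ->
  codefinable (fun v => R v -> R' v) (fun v => S v -> S' v).
Proof.
  intros (q & w & HR & HS) (q' & w' & HR' & HS').
  exists (Imp (rename left_params q) (rename right_params q')), (mix w w').
  split; intros v; cbn.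
  - now rewrite (sat_rename _ _ _ left_params_inj),
      (sat_rename _ _ _ right_params_inj), mix_left_params, mix_right_params, HR, HR'.
  - now rewrite (sat_rename _ _ _ left_params_inj),
      (sat_rename _ _ _ right_params_inj), comp_mix, mix_left_params,
      mix_right_params, HS, HS'.
Qed.

Lemma codefinable_all x R S : codefinable R S ->
  codefinable (fun v => forall d, R (upd v x d)) (fun v => forall d, S (upd v x d)).
Proof.
  intros (q & w & HR & HS); exists (All (2 * x) q), w.
  split; intros v; cbn -[Nat.mul]; split; intros H d; specialize (H d); revert H;
    now rewrite mix_upd, ?HR, ?HS.
Qed.

Lemma codefinable_all_in x b R S : codefinable R S ->
  codefinable (fun v => forall d, mem A d b -> R (upd v x d))
              (fun v => forall d, mem N d (i b) -> S (upd v x d)).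
Proof.
  intros H.
  destruct (codefinable_all x _ _ (codefinable_imp _ _ _ _ (codefinable_mem_param x b) H))
    as (q & w & HR & HS).
  exists q, w; split; intros v; [rewrite <- HR|rewrite <- HS];
    split; intros K d; specialize (K d); revert K; now rewrite upd_same.
Qed.

Hypothesis i_elem : elementary A N i.

Lemma codefinable_transfer R S : codefinable R S ->
  forall v, R v <-> S (fun n => i (v n)).
Proof.
  intros (q & w & HR & HS) v; rewrite HR, HS, (i_elem q), comp_mix; easy.
Qed.

Definition in_box {V : Type} (B : structure V) (n : nat) (a : B) (v : nat -> B) : Prop :=
  forall k, k < n -> mem B (v k) a.

(* Only the first [n] values of an assignment into [N] can be bounded by one
   set of [M]; the others are required to come from [M]. *)
Definition based (n : nat) (v : nat -> N) : Prop :=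
  exists u : nat -> A, forall k, n <= k -> v k = i (u k).

(** Elementarity speaks only of assignments from [A]. The values of [v] below [n] are therefore
    absorbed one at a time into quantifiers bounded by [a]; once none is left, the whole assignment
    comes from [A]. *)
Lemma codefinable_transfer_box n a R S : codefinable R S ->
  (forall v, in_box A n a v -> R v) ->
  forall v, in_box N n (i a) v -> based n v -> S v.
Proof.
  revert R S; induction n as [|n IH]; intros R S D H v Hv [u Hu].
  - replace v with (fun k => i (u k)).
    + apply (codefinable_transfer R S D), H; intros k Hk; lia.
    + apply functional_extensionality; intros k; symmetry; apply Hu; lia.
  (* The value at [n] becomes the instance of a bounded quantifier. Its slot is filled by the
     placeholder [i a], so that the remaining assignment is based at [n]. *)
  - rewrite <- (upd_self v n), <- (upd_upd v n (i a)).
    apply (IH _ _ (codefinable_all_in n a _ _ D)).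
    + intros w Hw d Hd; apply H; intros k Hk; unfold upd.
      destruct (Nat.eqb_spec k n); [easy|]; apply Hw; lia.
    + intros k Hk; rewrite upd_other by lia; apply Hv; lia.
    + exists (upd u n a); intros k Hk; unfold upd.
      destruct (Nat.eqb_spec k n); [easy|]; apply Hu; lia.
    + apply Hv; lia.
Qed.

Lemma subset_transfer a b : (forall z, mem A z a -> mem A z b) ->
  forall z, mem N z (i a) -> mem N z (i b).
Proof.
  intros H z Hz.
  apply (codefinable_transfer_box 1 a _ _ (codefinable_mem_param 0 b)
           (fun v Hv => H _ (Hv 0 Nat.lt_0_1)) (upd (fun _ => i a) 0 z)).
  - intros [|k] Hk; [easy|lia].
  - exists (fun _ => a); intros [|k] Hk; [lia|easy].
Qed.

Lemma in_box_upd {V : Type} (B : structure V) n (a : B) v x d :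
  in_box B n a v -> mem B d a -> in_box B n a (upd v x d).
Proof.
  intros Hv Hd k Hk; unfold upd; destruct (Nat.eqb k x); [easy|now apply Hv].
Qed.

Lemma in_box_subset {V : Type} (B : structure V) n (a b : B) v :
  (forall z, mem B z a -> mem B z b) -> in_box B n a v -> in_box B n b v.
Proof. intros H Hv k Hk; apply H, Hv, Hk. Qed.

Lemma based_upd n v x d : x < n -> based n v -> based n (upd v x d).
Proof.
  intros Hx [u Hu]; exists u; intros k Hk; rewrite upd_other by lia; auto.
Qed.

End Codefinable.

(** * Consequences of ZFC *)

Section SetTheory.
Context {U : Type} (M : structure U) (hM : models M (ZFC U)).

Lemma pairing (a b : M) : exists c, forall z, mem M z c <-> z = a \/ z = b.
Proof.
  pose proof (hM _ (ZFC_pair U) (fun _ => a) a b) as H.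
  apply sat_Ex in H as [c H]; exists c; intros z.
  specialize (H z); rewrite sat_Iff, sat_Or in H; exact H.
Qed.

Lemma union (a : M) :
  exists c, forall z, mem M z c <-> exists y, mem M y a /\ mem M z y.
Proof.
  pose proof (hM _ (ZFC_union U) (fun _ => a) a) as H.
  apply sat_Ex in H as [c H]; exists c; intros z.
  specialize (H z); rewrite sat_Iff, sat_ExIn in H by easy; exact H.
Qed.

Lemma binary_union (a b : M) :
  exists c, forall z, mem M z c <-> mem M z a \/ mem M z b.
Proof.
  destruct (pairing a b) as [p Hp], (union p) as [c Hc].
  exists c; intros z; rewrite Hc; split.
  - intros (y & Hy & Hz); apply Hp in Hy as [->| ->]; auto.
  - intros [Hz|Hz]; [exists a|exists b]; rewrite Hp; auto.
Qed.

Lemma separation (p : form U) x a b (v : nat -> M) :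
  x <> a -> x <> b -> a <> b -> ~ free b p ->
  exists c, forall z,
    mem M z c <-> mem M z (v a) /\ sat M (upd (upd v b c) x z) p.
Proof.
  intros xa xb ab Hb.
  pose proof (hM _ (ZFC_sep U x a b p xa xb ab Hb) v (v a)) as H.
  rewrite upd_self in H; apply sat_Ex in H as [c H]; exists c; intros z.
  specialize (H z); rewrite sat_Iff, sat_And in H; cbn in H.
  rewrite upd_same in H; rewrite !(upd_other _ x) in H by congruence.
  rewrite upd_same, (upd_other _ b) in H by congruence; exact H.
Qed.

Lemma collection (p : form U) x y a b (v : nat -> M) :
  x <> y -> x <> a -> x <> b -> y <> a -> y <> b -> a <> b -> ~ free b p ->
  (forall s, mem M s (v a) -> exists d, sat M (upd (upd v x s) y d) p) ->
  exists c, forall s, mem M s (v a) ->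
    exists d, mem M d c /\ sat M (upd (upd (upd v b c) x s) y d) p.
Proof.
  intros xy xa xb ya yb ab Hb Hp.
  pose proof (hM _ (ZFC_coll U x y a b p xy xa xb ya yb ab Hb) v (v a)) as H.
  rewrite upd_self in H.
  assert (E : sat M v (AllIn x a (Ex y p))).
  { apply sat_AllIn; [easy|]; intros s Hs; now apply sat_Ex, Hp. }
  apply H, sat_Ex in E as [c Hc]; clear H; exists c; intros s Hs.
  rewrite sat_AllIn in Hc by easy.
  rewrite upd_other in Hc by easy.
  apply Hc, sat_ExIn in Hs as (d & Hd & Hs); [|easy].
  rewrite upd_other, upd_same in Hd by congruence; eauto.
Qed.

(* [closed_witness n x p k] says, for variables [n] and [n.+1] denoting [b] and
   [a]: for all values in [a] of the variables below [k], if some [x] satisfies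
   [p], then some [x] in [b] does. *)
Fixpoint closed_witness (n x : nat) (p : form U) (k : nat) : form U :=
  match k with
  | 0 => Imp (Ex x p) (ExIn x n p)
  | S k => AllIn k (S n) (closed_witness n x p k)
  end.

Lemma vars_below_closed_witness n x p k : x < n -> vars_below n p -> k <= n ->
  vars_below (S (S n)) (closed_witness n x p k).
Proof.
  intros Hx Hp.
  assert (Hp' : vars_below (S (S n)) p) by (apply (vars_below_le p n); easy || lia).
  induction k as [|k IH]; cbn; intros Hk; repeat split; easy || lia || (apply IH; lia).
Qed.

Lemma sat_closed_witness n x p k : x < n -> vars_below n p -> k <= n ->
  forall v : nat -> M, sat M v (closed_witness n x p k) <->
    forall v', in_box M k (v (S n)) v' -> (forall j, k <= j -> v' j = v j) ->
      (exists d, sat M (upd v' x d) p) ->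
      exists d, mem M d (v n) /\ sat M (upd v' x d) p.
Proof.
  intros Hx Hp; induction k as [|k IH]; intros Hk v.
  - cbn [closed_witness sat]; rewrite sat_Ex, sat_ExIn by lia.
    split.
    + intros H v' _ E; replace v' with v; [exact H|].
      apply functional_extensionality; intros j; symmetry; apply E; lia.
    + intros H; apply (H v); [|easy]; intros j Hj; lia.
  - cbn [closed_witness]; rewrite sat_AllIn by lia; split.
    + intros H v' Hv' E.
      pose proof (H (v' k) (Hv' k ltac:(lia))) as H'.
      rewrite (IH ltac:(lia)), !upd_other in H' by lia.
      apply H'.
      * intros j Hj; apply Hv'; lia.
      * intros j Hj; unfold upd; destruct (Nat.eqb_spec j k) as [->|]; [easy|].
        apply E; lia.
    + intros H d Hd; apply (IH ltac:(lia)); rewrite !upd_other by lia.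
      intros v' Hv' E; apply H.
      * intros j Hj; destruct (Nat.eq_dec j k) as [->|]; [|apply Hv'; lia].
        now rewrite E, upd_same by lia.
      * intros j Hj; rewrite E, upd_other by lia; easy.
Qed.

(** The variable [n] denoting the bound does not occur in [p], so enlarging the bound leaves the
    meaning of [p] unchanged. *)
Lemma closed_witness_mono n x p k (v : nat -> M) b b' :
  x < n -> vars_below n p -> k <= n -> (forall z, mem M z b -> mem M z b') ->
  sat M (upd v n b) (closed_witness n x p k) ->
  sat M (upd v n b') (closed_witness n x p k).
Proof.
  intros Hx Hp Hk Hb.
  rewrite !sat_closed_witness, !upd_same, !(upd_other v n) by easy || lia.
  intros H v' Hv' E He.
  assert (E' : forall e, sat M (upd v' x e) p <-> sat M (upd (upd v' n b) x e) p).
  { intros e; apply (sat_agree M p n Hp); intros j Hj; unfold upd.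
    destruct (Nat.eqb j x), (Nat.eqb_spec j n); easy || lia. }
  destruct (H (upd v' n b)) as (e & Hm & Hs).
  - intros j Hj; rewrite upd_other by lia; auto.
  - intros j Hj; unfold upd; destruct (Nat.eqb_spec j n) as [->|ne]; [easy|].
    rewrite E, upd_other by easy; easy.
  - destruct He as [e He]; exists e; now apply E'.
  - exists e; split; [auto|]; now apply E'.
Qed.

(** Induction on [k]. With all values fixed, the singleton of one witness is a bound. To let
    variable [k] range over the box, Collection gathers bounds for its values into a set [B], and
    the union of [B] bounds them all by monotonicity. *)
Lemma closed_witness_exists n x p k : x < n -> vars_below n p -> k <= n ->
  forall v : nat -> M, exists b, sat M (upd v n b) (closed_witness n x p k).
Proof.
  intros Hx Hp; induction k as [|k IH]; intros Hk v.
  - cbn [closed_witness sat].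
    destruct (classic (exists d, sat M (upd v x d) p)) as [[d Hd]|Hn].
    + destruct (pairing d d) as [b Hb]; exists b; intros _.
      rewrite sat_ExIn, upd_same by lia; exists d; split; [apply Hb; auto|].
      revert Hd; apply (sat_agree M p n Hp); intros j Hj; unfold upd.
      destruct (Nat.eqb j x), (Nat.eqb_spec j n); easy || lia.
    (* Without a witness the implication is vacuous, and any set serves as bound. *)
    + exists (v 0); rewrite sat_Ex; intros [d Hd]; destruct Hn; exists d.
      revert Hd; apply (sat_agree M p n Hp); intros j Hj; unfold upd.
      destruct (Nat.eqb j x), (Nat.eqb_spec j n); easy || lia.
  - pose proof (vars_below_closed_witness n x p k Hx Hp ltac:(lia)) as V.
    destruct (collection (closed_witness n x p k) k n (S n) (S (S n)) v)
      as [B HB]; try lia.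
    { now apply vars_below_not_free. }
    { intros s _; apply IH; lia. }
    destruct (union B) as [b Hb]; exists b; cbn [closed_witness].
    rewrite sat_AllIn, upd_other by lia; intros s Hs.
    apply HB in Hs as (c & Hc & Hs).
    assert (E : forall d, sat M (upd (upd v n b) k s) (closed_witness n x p k) <->
      sat M (upd (upd (upd v (S (S n)) d) k s) n b) (closed_witness n x p k)).
    { intros d; apply (sat_agree M _ _ V); intros j Hj; unfold upd.
      destruct (Nat.eqb_spec j k), (Nat.eqb_spec j n), (Nat.eqb_spec j (S (S n)));
        easy || lia. }
    rewrite (E B); revert Hs; apply closed_witness_mono; try easy; try lia.
    intros z Hz; apply Hb; eauto.
Qed.

Lemma witness_bound n x p (a : M) : x < n -> vars_below n p ->
  exists b, forall v, in_box M n a v ->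
    (exists d, sat M (upd v x d) p) -> exists d, mem M d b /\ sat M (upd v x d) p.
Proof.
  intros Hx Hp.
  destruct (closed_witness_exists n x p n Hx Hp (le_n n) (fun _ => a)) as [b Hb].
  exists b; intros v Hv.
  rewrite sat_closed_witness, upd_same, upd_other in Hb by easy || lia.
  (* [closed_witness] only speaks of assignments that agree with the fixed one from [n] on, so [v]
     is kept just on the variables of [p]. *)
  set (v' := fun j => if j <? n then v j else upd (fun _ => a) n b j).
  assert (E : forall d, sat M (upd v x d) p <-> sat M (upd v' x d) p).
  { intros d; apply (sat_agree M p n Hp); intros j Hj; unfold upd, v'.
    destruct (Nat.eqb j x); [easy|]; destruct (Nat.ltb_spec j n); easy || lia. }
  intros [d Hd]; destruct (Hb v') as (e & He & He').
  - intros j Hj; unfold v'; destruct (Nat.ltb_spec j n); [auto|lia].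
  - intros j Hj; unfold v'; destruct (Nat.ltb_spec j n); [lia|easy].
  - exists d; now apply E.
  - exists e; now rewrite E.
Qed.

Lemma in_box_exists n (v : nat -> M) : exists a, in_box M n a v.
Proof.
  induction n as [|n [a Ha]].
  - exists (v 0); intros k Hk; lia.
  - destruct (pairing (v n) (v n)) as [s Hs], (binary_union a s) as [c Hc].
    exists c; intros k Hk; apply Hc.
    destruct (Nat.eq_dec k n) as [->|]; [right; apply Hs; auto|left; apply Ha; lia].
Qed.

End SetTheory.

(** * The expansion *)

Section Expansion.
Context (M : structure LX) (hM : models M (ZFC LX)).
Context (N : structure L) (i : reduct M -> N).
Hypothesis hi : cofinal_elementary (reduct M) N i.

Definition extended_pred (d : N) : Prop :=
  exists c : M, (forall z, mem M z c -> pred M tt z) /\ mem N d (i c).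

(** The box [a] is chosen after [p], because the quantifier case uses the induction hypothesis on
    larger boxes. The relations [R] and [S] depend on the box. *)
Lemma formula_codefinable (p : form LX) n : vars_below n p -> forall a : M,
  exists R S, codefinable (reduct M) N i R S /\
    (forall v, in_box M n a v -> sat M v p <-> R v) /\
    (forall v, in_box N n (i a) v -> based (reduct M) N i n v ->
       sat (expand N extended_pred) v p <-> S v).
Proof.
  destruct hi as [i_elem i_cof].
  induction p as [x y|x y|u x| |p IHp q IHq|x p IHp]; cbn [vars_below]; intros Hp a.
  - do 2 eexists; split; [apply (codefinable_mem _ _ _ x y)|easy].
  - do 2 eexists; split; [apply (codefinable_eq _ _ _ x y)|easy].
  (* [c] is the part of [a] on which [X] holds; on the box it replaces [X]. *)
  - destruct (separation M hM (Pred u 0) 0 1 2 (fun _ => a)) as [c Hc]; try easy.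
    do 2 eexists; split; [apply (codefinable_mem_param (reduct M) N i x c)|].
    destruct u; cbn in Hc; split; intros v Hv; cbn.
    + rewrite Hc; split; [intros H; split; [now apply Hv|easy]|easy].
    + intros _; split.
      * intros (c' & Hc' & Hx).
        pose proof (Hv x Hp) as Ha.
        (* If all elements of [c'] satisfy [X], then in [M] every element of [a] lying in [c'] lies
           in [c]. This inclusion transfers to [N]. *)
        apply (codefinable_transfer_box (reduct M) N i i_elem 1 a _ _
          (codefinable_imp (reduct M) N i _ _ _ _
             (codefinable_mem_param (reduct M) N i 0 c')
             (codefinable_mem_param (reduct M) N i 0 c)))
          with (v := upd (fun _ => i a) 0 (v x)).
        -- intros w Hw Hw'; apply Hc; split; [exact (Hw 0 Nat.lt_0_1)|exact (Hc' _ Hw')].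
        -- intros [|k] Hk; [easy|lia].
        -- exists (fun _ => a); intros [|k] Hk; [lia|easy].
        -- exact Hx.
      * intros H; exists c; split; [|easy]; intros z Hz; now apply Hc.
  - do 2 eexists; split; [apply codefinable_bot|easy].
  - destruct (IHp (proj1 Hp) a) as (R & S & D & HR & HS).
    destruct (IHq (proj2 Hp) a) as (R' & S' & D' & HR' & HS').
    do 2 eexists; split; [apply (codefinable_imp (reduct M) N i _ _ _ _ D D')|].
    split; intros v Hv; cbn.
    + now rewrite HR, HR'.
    + intros Hb; now rewrite HS, HS'.
  - destruct Hp as [Hx Hp].
    (* [b0] bounds counterexamples to [p]. Joining [a] to it keeps updated assignments inside the
       box of [b]. *)
    destruct (witness_bound M hM n x (Not p) a Hx) as [b0 Hb0]; [easy|].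
    destruct (binary_union M hM a b0) as [b Hb].
    assert (ab : forall z, mem M z a -> mem M z b) by (intros z Hz; apply Hb; auto).
    destruct (IHp Hp b) as (R & S & D & HR & HS).
    pose proof (codefinable_all_in (reduct M) N i x b _ _ D) as Dall.
    assert (HRall : forall v, in_box M n a v -> sat M v (All x p) <->
              forall d, mem M d b -> R (upd v x d)).
    { intros v Hv; cbn; split.
      - intros H d Hd; apply HR, H.
        apply in_box_upd; [now apply (in_box_subset M n a b)|easy].
      - intros H; apply NNPP; intros Hn.
        destruct (Hb0 v Hv) as (d & Hd & Hd').
        + apply not_all_ex_not, Hn.
        + assert (Hdb : mem M d b) by (apply Hb; auto).
          apply Hd'; apply HR; [|now apply H].
          apply in_box_upd; [now apply (in_box_subset M n a b)|easy]. }
    do 2 eexists; split; [exact Dall|]; split; [exact HRall|].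
    intros v Hv Hbase; cbn; split.
    + intros H d Hd; apply HS, H.
      * apply in_box_upd; [|exact Hd].
        apply (in_box_subset N n (i a) (i b)); [|exact Hv].
        now apply (subset_transfer (reduct M) N i i_elem).
      * now apply based_upd.
    + intros H d.
      (* [d] may lie outside [i b]. Cofinality puts it into some [i e], and [b'] covers both [a] and
         [e]. *)
      destruct (i_cof d) as [e He], (binary_union M hM a e) as [b' Hb'].
      assert (ab' : forall z, mem M z a -> mem M z b')
        by (intros z Hz; apply Hb'; auto).
      assert (eb' : forall z, mem M z e -> mem M z b')
        by (intros z Hz; apply Hb'; auto).
      assert (Hd : mem N d (i b'))
        by (revert He; now apply (subset_transfer (reduct M) N i i_elem)).
      destruct (IHp Hp b') as (R' & S' & D' & HR' & HS').
      apply HS'.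
      * apply in_box_upd; [|exact Hd].
        apply (in_box_subset N n (i a) (i b')); [|exact Hv].
        now apply (subset_transfer (reduct M) N i i_elem).
      * now apply based_upd.
      (* [S] and [S'] come from different boxes and are compared through [M]: there, on the box of
         [a], [R] throughout [b] makes [All x p] true, hence gives [R'] throughout [b']. This
         implication is codefinable and transfers. *)
      * apply (codefinable_transfer_box (reduct M) N i i_elem n a _ _
          (codefinable_imp (reduct M) N i _ _ _ _ Dall
             (codefinable_all_in (reduct M) N i x b' _ _ D'))) with (v := v); try easy.
        intros w Hw Hall f Hf; apply HR'.
        -- apply (in_box_upd M n b' w x f); [exact (in_box_subset M n a b' w ab' Hw)|exact Hf].
        -- exact (proj2 (HRall w Hw) Hall f).
Qed.

Lemma expansion_elementary : elementary M (expand N extended_pred) i.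
Proof.
  intros p v.
  destruct (vars_below_exists p) as [n Hn], (in_box_exists M hM n v) as [a Ha].
  destruct (formula_codefinable p n Hn a) as (R & S & D & HR & HS).
  rewrite (HR v Ha), HS.
  - now apply codefinable_transfer; [apply hi|].
  - intros k Hk.
    exact (proj1 (proj1 hi (Mem 0 1) (fun j => if j =? 0 then v k else a)) (Ha k Hk)).
  - now exists v.
Qed.

End Expansion.

Theorem theorem6p3 (M : structure LX) (hM : models M (ZFC LX))
    (N : structure L) (i : reduct M -> N)
    (hi : cofinal_elementary (reduct M) N i) :
  exists XN : N -> Prop,
    (forall x : M, pred M tt x -> XN (i x)) /\ elementary M (expand N XN) i.
Proof.
  exists (extended_pred M N i).
  pose proof (expansion_elementary M hM N i hi) as H.
  split; [|exact H].
  (* The inclusion of the predicates is elementarity for the atomic formula [X]. *)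
  intros x; exact (proj1 (H (Pred tt 0) (fun _ => x))).
Qed.
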